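(* Let $S^{(A)},S^{(B)}$ be finite-dimensional quantum systems with Hamiltonians $H^{(A)},H^{(B)}$, and let $\beta^{(A)},\beta^{(B)}$ be inverse temperatures. The set of semilocal thermal operations with respect to $(\beta^{(A)},\beta^{(B)})$ is closed under composition: if $\Lambda_1^{(AB)}$ and $\Lambda_2^{(AB)}$ are semilocal thermal operations with respect to $(\beta^{(A)},\beta^{(B)})$, then $\Lambda_2^{(AB)}\circ\Lambda_1^{(AB)}$ is a semilocal thermal operation with respect to the same pair $(\beta^{(A)},\beta^{(B)})$.
   Context: The joint system $S=S^{(A)}\otimes S^{(B)}$ has Hamiltonian $H^{(A)}+H^{(B)}$ (each term extended by identities). A map $\Lambda^{(AB)}$ on states of $S$ is a semilocal thermal operation (SLTO) with respect to local inverse temperatures $\beta^{(A)},\beta^{(B)}$ if there exist two bath systems $\mathcal B^{(A)},\mathcal B^{(B)}$ with Hamiltonians $H^{\mathcal B^{(A)}},H^{\mathcal B^{(B)}}$ and a unitary $U$ on baths and system such that $$\Lambda^{(AB)}(\rho)=\mathrm{Tr}_{\mathcal B^{(A)},\mathcal B^{(B)}}\big[U(\gamma^{\mathcal B^{(A)}}\otimes\gamma^{\mathcal B^{(B)}}\otimes\rho)U^\dagger\big],$$ where $\gamma^{\mathcal B^{(X)}}=e^{-\beta^{(X)}H^{\mathcal B^{(X)}}}/\mathrm{Tr}(e^{-\beta^{(X)}H^{\mathcal B^{(X)}}})$ for $X\in\{A,B\}$, and $$[U,H^{(A)}+H^{(B)}+H^{\mathcal B^{(A)}}+H^{\mathcal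 B^{(B)}}]=0,\qquad [U,\beta^{(A)}(H^{(A)}+H^{\mathcal B^{(A)}})+\beta^{(B)}(H^{(B)}+H^{\mathcal B^{(B)}})]=0.$$ The baths, their Hamiltonians and $U$ may depend on the operation. *)

(* Defs.v *)
From HB Require Import structures.
From mathcomp Require Import all_boot all_order all_algebra.
From mathcomp Require Import complex mxtens.
From mathcomp Require Import all_classical all_reals all_analysis.

Set Implicit Arguments.
Unset Strict Implicit.
Unset Printing Implicit Defensive.

Import Order.TTheory GRing.Theory Num.Theory.
Import numFieldNormedType.Exports.

Local Open Scope ring_scope.
Local Open Scope classical_set_scope.
Local Open Scope sesquilinear_scope.
Local Open Scope complex_scope.

(* Stated over an abstract numFieldType because R[i] gets its (norm) topology
   only through that structure. *)
Definition expmx (C : numFieldType) (n : nat) (A : 'M[C]_n) : 'M[C]_n :=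
  limn (series (fun k => (k`!%:R)^-1 *: A ^+ k)).

Definition psdmx (R : realType) (n : nat) (A : 'M[R[i]]_n) : Prop :=
  A \is hermsymmx /\ forall u : 'rV[R[i]]_n, 0 <= (u *m A *m u^t*) 0 0.

Record state (R : realType) (n : nat) := State {
  state_mx :> 'M[R[i]]_n;
  state_psd : psdmx state_mx;
  state_tr1 : \tr state_mx = 1
}.

Record qsystem (R : realType) := QSystem {
  qdim : nat;
  qdim_gt0 : (0 < qdim)%N;
  ham : 'M[R[i]]_qdim;
  ham_herm : ham \is hermsymmx
}.

Definition gibbs (R : realType) (beta : R) (B : qsystem R) :
    'M[R[i]]_(qdim B) :=
  let E := expmx ((- beta)%:C *: ham B) in (\tr E)^-1 *: E.

(* Partial trace over the left tensor factor. *)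
Definition ptracel (R : realType) (m n : nat) (X : 'M[R[i]]_(m * n)) :
    'M[R[i]]_n :=
  \matrix_(i < n, j < n)
    \sum_(k < m) X (mxtens_index (k, i)) (mxtens_index (k, j)).

Section SemilocalThermalOperations.
Variables (R : realType) (SA SB BA BB : qsystem R).

Definition sys_dim : nat := (qdim SA * qdim SB)%N.

(* The global space is (BA (x) BB) (x) (SA (x) SB), in this order. *)
Definition total_dim : nat := (qdim BA * qdim BB * sys_dim)%N.

Definition hamSA : 'M[R[i]]_total_dim :=
  (1%:M : 'M[R[i]]_(qdim BA * qdim BB)) *t
    (ham SA *t (1%:M : 'M[R[i]]_(qdim SB))).
Definition hamSB : 'M[R[i]]_total_dim :=
  (1%:M : 'M[R[i]]_(qdim BA * qdim BB)) *t
    ((1%:M : 'M[R[i]]_(qdim SA)) *t ham SB).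
Definition hamBA : 'M[R[i]]_total_dim :=
  (ham BA *t (1%:M : 'M[R[i]]_(qdim BB))) *t (1%:M : 'M[R[i]]_sys_dim).
Definition hamBB : 'M[R[i]]_total_dim :=
  ((1%:M : 'M[R[i]]_(qdim BA)) *t ham BB) *t (1%:M : 'M[R[i]]_sys_dim).

Definition slto_unitary (bA bB : R) (U : 'M[R[i]]_total_dim) : Prop :=
  [/\ U \is unitarymx,
      comm_mx U (hamSA + hamSB + hamBA + hamBB) &
      comm_mx U (bA%:C *: (hamSA + hamBA) + bB%:C *: (hamSB + hamBB))].

Definition slto_map (bA bB : R) (U : 'M[R[i]]_total_dim)
    (rho : 'M[R[i]]_sys_dim) : 'M[R[i]]_sys_dim :=
  ptracel (U *m ((gibbs bA BA *t gibbs bB BB) *t rho) *m U^t*).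

End SemilocalThermalOperations.

Definition slto (R : realType) (SA SB : qsystem R) (bA bB : R)
    (L : state R (sys_dim SA SB) -> state R (sys_dim SA SB)) : Prop :=
  exists (BA BB : qsystem R) (U : 'M[R[i]]_(total_dim SA SB BA BB)),
    slto_unitary bA bB U /\
    forall rho, L rho = slto_map bA bB U rho :> 'M[R[i]]_(sys_dim SA SB).

(* Main.v *)
(* The composite operation uses the baths BA1 (x) BA2 and BB1 (x) BB2 with
   noninteracting Hamiltonians, and the unitary U2 U1 in which U1 acts only on
   (BA1, BB1, S) and U2 only on (BA2, BB2, S).  Each Ui commutes with the
   Hamiltonians of the baths it does not touch, so both conservation laws are
   inherited.  The Gibbs state of a composite bath is the product of the Gibbs
   states (diagonalize both Hamiltonians), so the partial trace over
   (BA1, BB1) can be taken before U2 acts, leaving the output of the first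
   operation next to fresh second baths. *)
Require Import Defs.
From mathcomp Require Import all_boot all_order all_algebra.
From mathcomp Require Import complex all_reals.
From mathcomp Require Import mxtens all_classical all_analysis.

Set Implicit Arguments.
Unset Strict Implicit.
Unset Printing Implicit Defensive.

Import Order.TTheory GRing.Theory Num.Theory.
Import numFieldNormedType.Exports.

Local Open Scope ring_scope.
Local Open Scope classical_set_scope.
Local Open Scope sesquilinear_scope.
Local Open Scope complex_scope.

(** * Matrix limits and exponentials of diagonalizable matrices *)

Lemma cvg_mx_coord (T : topologicalType) (m n : nat) (U : Type)
    (F : set_system U) (FF : Filter F) (f : U -> 'M[T]_(m, n)) (M : 'M[T]_(m, n)) :
  (forall i j, f x i j @[x --> F] --> M i j) -> f @ F --> M.
Proof.
move=> fM A [P MP sPA].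
(* Only finitely many entries have to be controlled at once, so their neighbourhoods can be
   intersected inside the filter. *)
have : \forall x \near F, forall ij : 'I_m * 'I_n, P ij.1 ij.2 (f x ij.1 ij.2).
  by apply: filter_forall => -[i j]; apply: fM; exact: MP.
by apply: filterS => x Px; apply: sPA => i j; exact: (Px (i, j)).
Qed.

(** Separation is needed only for scalars: coordinates are continuous, so two limits agree entry by
    entry. This turns a convergence proof into an equation for the [limn] inside [expmx]. *)
Lemma mx_lim_unique (K : numFieldType) (m n : nat) (u : nat -> 'M[K]_(m, n)) M :
  u @ \oo --> M -> limn u = M.
Proof.
move=> uM; have uL : u @ \oo --> limn u by apply/cvg_ex; exists M.
apply/matrixP => i j.
have c (L : 'M[K]_(m, n)) : u @ \oo --> L -> u k i j @[k --> \oo] --> L i j.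
  by move=> uL'; exact: (continuous_cvg _ (@coord_continuous K m n i j L) uL').
exact: (cvg_unique (@norm_hausdorff _ K^o) (c _ uL) (c _ uM)).
Qed.

Lemma cvg_real_complex (R : realType) (u : nat -> R) (l : R) :
  u @ \oo --> l ->
  ((u k)%:C : (R[i] : numFieldType)) @[k --> \oo] -->
  (l%:C : (R[i] : numFieldType)).
Proof.
(* In the order of [R[i]], a positive [e] has zero imaginary part, so the complex radius is a real
   one and the real convergence applies. *)
move=> ul; apply/cvgrPdist_lt => e; rewrite ltcE => /andP[/eqP e0 ep].
have /cvgrPdist_lt/(_ _ ep) := ul; apply: filterS => k.
rewrite -rmorphB normc_def /= expr0n /= addr0 sqrtr_sqr ltcE /= e0 eqxx /=.
by [].
Qed.

(** All powers are diagonal in the same basis, so each entry of a partial sum is a fixed finite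
    linear combination of scalar partial sums, one per eigenvalue. *)
Lemma expmx_similar_diag (C : numFieldType) (n : nat) (P : 'M[C]_n)
    (d e : 'rV[C]_n) : P \in unitmx ->
  (forall l, series (fun k => (k`!%:R)^-1 * d 0 l ^+ k) @ \oo --> e 0 l) ->
  expmx (invmx P *m diag_mx d *m P) = invmx P *m diag_mx e *m P.
Proof.
move=> Pu cvg_e; set A := _ *m P.
have powA k : A ^+ k =
    invmx P *m diag_mx (map_mx (fun x => x ^+ k) d) *m P.
  elim: k => [|k IHk].
    rewrite expr0; rewrite [X in diag_mx X](_ : _ = const_mx 1).
      by rewrite diag_const_mx mulmx1 mulVmx.
    by apply/rowP => j; rewrite !mxE expr0.
  rewrite exprSr IHk -mulmxE /A.
  rewrite -!mulmxA (mulKVmx Pu) !mulmxA.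
  rewrite -[_ *m diag_mx d]mulmxA mulmx_diag.
  congr (_ *m diag_mx _ *m _).
  by apply/rowP => j; rewrite !mxE exprSr.
have entry (c : 'rV[C]_n) i j : (invmx P *m diag_mx c *m P) i j =
    \sum_l invmx P i l * P l j * c 0 l.
  rewrite mxE; apply: eq_bigr => l _; rewrite mul_mx_diag mxE.
  by rewrite mulrAC.
apply: mx_lim_unique; apply: cvg_mx_coord => i j.
rewrite entry.
have term k : ((k`!%:R)^-1 *: A ^+ k) i j =
    \sum_l invmx P i l * P l j * ((k`!%:R)^-1 * d 0 l ^+ k).
  rewrite mxE powA entry big_distrr /=; apply: eq_bigr => l _.
  by rewrite mxE mulrCA.
have -> : (fun k => series (fun k => (k`!%:R)^-1 *: A ^+ k) k i j) =
   (fun k => \sum_l invmx P i l * P l j *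
      series (fun k => (k`!%:R)^-1 * d 0 l ^+ k) k).
  apply/funext => k; rewrite /series /= summxE (eq_bigr _ (fun q _ => term q)).
  rewrite exchange_big /=; apply: eq_bigr => l _.
  by rewrite big_distrr.
apply: cvg_big => [|l _]; first exact: add_continuous.
exact: cvgMl_tmp.
Qed.

Lemma expmx_similar_real_diag (R : realType) (n : nat) (P : 'M[R[i]]_n)
    (d : 'rV[R]_n) : P \in unitmx ->
  expmx (invmx P *m diag_mx (map_mx (real_complex R) d) *m P) =
  invmx P *m diag_mx (map_mx (fun x => (expR x)%:C) d) *m P.
Proof.
move=> Pu; apply: expmx_similar_diag => // l; rewrite !mxE.
rewrite (_ : series _ = fun k => (series (exp_coeff (d 0 l)) k)%:C).
  (* [expR] is defined as the limit of this series, so convergence of the series is all that is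
     left. *)
  apply: cvg_real_complex; exact: is_cvg_series_exp_coeff.
apply/funext => k.
rewrite /series /= rmorph_sum; apply: eq_bigr => q _.
by rewrite /exp_coeff /= mulrC rmorphM fmorphV rmorphXn rmorph_nat.
Qed.

(** Spectral theorem. The eigenvalues are real, so taking real parts loses nothing; a real [d] makes
    [expR] available. *)
Lemma hermsymmx_diagonalizable (R : realType) (n : nat) (A : 'M[R[i]]_n) :
  A \is hermsymmx -> exists (P : 'M[R[i]]_n) (d : 'rV[R]_n), P \in unitmx /\
    A = invmx P *m diag_mx (map_mx (real_complex R) d) *m P.
Proof.
move=> hA; exists (spectralmx A), (map_mx (@complex.Re R) (spectral_diag A)).
split; first exact: spectral_unit.
rewrite [LHS](orthomx_spectralP (hermitian_normalmx hA)).
congr (_ *m diag_mx _ *m _); apply/rowP => j; rewrite !mxE.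
by rewrite RRe_real // (mxOverP (hermitian_spectral_diag_real hA)).
Qed.

(** * Algebra of tensor products and Hermitian matrices *)

Lemma tensmxDl (R : pzRingType) (m n p q : nat) (A B : 'M[R]_(m, n))
    (D : 'M[R]_(p, q)) : (A + B) *t D = A *t D + B *t D.
Proof. by apply/matrixP => i j; rewrite !mxE mulrDl. Qed.

Lemma tensmxDr (R : pzRingType) (m n p q : nat) (A : 'M[R]_(m, n))
    (B D : 'M[R]_(p, q)) : A *t (B + D) = A *t B + A *t D.
Proof. by apply/matrixP => i j; rewrite !mxE mulrDr. Qed.

Lemma tensmxZl (R : pzRingType) (m n p q : nat) (a : R) (A : 'M[R]_(m, n))
    (B : 'M[R]_(p, q)) : (a *: A) *t B = a *: (A *t B).
Proof. by apply/matrixP => i j; rewrite !mxE mulrA. Qed.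

Lemma tensmxZr (R : comPzRingType) (m n p q : nat) (a : R) (A : 'M[R]_(m, n))
    (B : 'M[R]_(p, q)) : A *t (a *: B) = a *: (A *t B).
Proof. by apply/matrixP => i j; rewrite !mxE mulrCA. Qed.

Lemma tensmx11 (R : pzRingType) (m n : nat) :
  (1%:M : 'M[R]_m) *t (1%:M : 'M[R]_n) = 1%:M.
Proof.
apply/matrixP => i j.
case: (mxtens_indexP i) => a b; case: (mxtens_indexP j) => c d.
rewrite tensmxE !mxE -natrM mulnb (inj_eq (can_inj (@mxtens_indexK m n))).
by rewrite xpair_eqE.
Qed.

Lemma sum_mxtens_index (V : nmodType) (m n : nat) (F : 'I_(m * n) -> V) :
  \sum_k F k = \sum_i \sum_j F (mxtens_index (i, j)).
Proof.
rewrite pair_bigA /= (reindex (@mxtens_index m n)); first by apply: eq_bigr => -[].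
exists (@mxtens_unindex m n) => k _; first exact: mxtens_indexK.
exact: mxtens_unindexK.
Qed.

Lemma mxtrace_tens (R : pzRingType) (m n : nat) (A : 'M[R]_m) (B : 'M[R]_n) :
  \tr (A *t B) = \tr A * \tr B.
Proof.
rewrite /mxtrace sum_mxtens_index big_distrl /=; apply: eq_bigr => i _.
by rewrite big_distrr /=; apply: eq_bigr => j _; rewrite tensmxE.
Qed.

Lemma hermsymmxP (C : numClosedFieldType) (n : nat) (A : 'M[C]_n) :
  reflect (A = A^t*) (A \is hermsymmx).
Proof.
by apply: (iffP (is_hermitianmxP _ _ _)); rewrite expr0 scale1r.
Qed.

Lemma tensmx_hermsym (C : numClosedFieldType) (m n : nat) (A : 'M[C]_m)
    (B : 'M[C]_n) :
  A \is hermsymmx -> B \is hermsymmx -> A *t B \is hermsymmx.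
Proof.
move=> /hermsymmxP hA /hermsymmxP hB; apply/hermsymmxP.
by rewrite trmx_tens map_mxT -hA -hB.
Qed.

Lemma hermsymmxD (C : numClosedFieldType) (n : nat) (A B : 'M[C]_n) :
  A \is hermsymmx -> B \is hermsymmx -> A + B \is hermsymmx.
Proof.
move=> /hermsymmxP hA /hermsymmxP hB; apply/hermsymmxP.
by rewrite [(A + B)^T]raddfD [LHS]/= map_mxD -hA -hB.
Qed.

Lemma hermsymmx1 (C : numClosedFieldType) (n : nat) :
  (1%:M : 'M[C]_n) \is hermsymmx.
Proof. by apply/hermsymmxP; rewrite trmx1 map_mx1. Qed.

Lemma hermsymmxZ (C : numClosedFieldType) (n : nat) (a : C) (A : 'M[C]_n) :
  a \is Num.real -> A \is hermsymmx -> a *: A \is hermsymmx.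
Proof.
move=> /CrealP ha /hermsymmxP hA; apply/hermsymmxP.
by apply/matrixP => i j; rewrite {1}hA !mxE rmorphM [in RHS]/= ha.
Qed.

Lemma tensmx_unitmx (C : fieldType) (m n : nat) (P : 'M[C]_m) (Q : 'M[C]_n) :
  P \in unitmx -> Q \in unitmx -> P *t Q \in unitmx.
Proof.
move=> Pu Qu; suff : (invmx P *t invmx Q) *m (P *t Q) = 1%:M.
  by case/mulmx1_unit.
by rewrite tensmx_mul !mulVmx // tensmx11.
Qed.

(** * Exponentials and Gibbs states of product systems *)

Lemma tensmx_similar_diag (C : fieldType) (m n : nat) (P D : 'M[C]_m)
    (Q E : 'M[C]_n) : P \in unitmx -> Q \in unitmx ->
  (invmx P *m D *m P) *t (invmx Q *m E *m Q) =
  invmx (P *t Q) *m (D *t E) *m (P *t Q).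
Proof.
move=> Pu Qu.
have PQ : (invmx P *t invmx Q) *m (P *t Q) = 1%:M.
  by rewrite tensmx_mul !mulVmx // tensmx11.
have -> : invmx (P *t Q) = invmx P *t invmx Q.
  by rewrite -[RHS]mulmx1 -(mulmxV (tensmx_unitmx Pu Qu)) mulmxA PQ mul1mx.
by rewrite -!tensmx_mul.
Qed.

Lemma tensmx_diag (C : pzRingType) (m n : nat) (d : 'rV[C]_m) (e : 'rV[C]_n) :
  diag_mx d *t diag_mx e =
  diag_mx (\row_k (d 0 (mxtens_unindex k).1 * e 0 (mxtens_unindex k).2)).
Proof.
apply/matrixP => i j.
case: (mxtens_indexP i) => a b; case: (mxtens_indexP j) => c f.
rewrite tensmxE !mxE mxtens_indexK (inj_eq (can_inj (@mxtens_indexK m n))).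
by rewrite xpair_eqE; case: eqP; case: eqP; rewrite ?mulr0n ?mulr1n ?mul0r ?mulr0.
Qed.

Lemma tensmx_sum_similar_diag (C : fieldType) (m n : nat) (P : 'M[C]_m)
    (Q : 'M[C]_n) (d : 'rV[C]_m) (e : 'rV[C]_n) :
  P \in unitmx -> Q \in unitmx ->
  (invmx P *m diag_mx d *m P) *t 1%:M + 1%:M *t (invmx Q *m diag_mx e *m Q) =
  invmx (P *t Q) *m
  diag_mx (\row_k (d 0 (mxtens_unindex k).1 + e 0 (mxtens_unindex k).2)) *m
  (P *t Q).
Proof.
move=> Pu Qu.
(* Writing the identities as conjugates of constant diagonals puts both summands in the common basis
   [P *t Q], where the eigenvalues add. *)
have -> : (1%:M : 'M[C]_n) = invmx Q *m diag_mx (const_mx 1) *m Q.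
  by rewrite diag_const_mx mulmx1 mulVmx.
have -> : (1%:M : 'M[C]_m) = invmx P *m diag_mx (const_mx 1) *m P.
  by rewrite diag_const_mx mulmx1 mulVmx.
rewrite !tensmx_similar_diag // -mulmxDl -mulmxDr !tensmx_diag -raddfD /=.
congr (_ *m diag_mx _ *m _).
by apply/rowP => k; rewrite !mxE mulr1 mul1r.
Qed.

(** In a joint eigenbasis the claim reduces to [expRD] on sums of eigenvalues; no product of matrix
    series is formed. *)
Lemma expmx_tens (R : realType) (m n : nat) (A : 'M[R[i]]_m) (B : 'M[R[i]]_n) :
  A \is hermsymmx -> B \is hermsymmx ->
  expmx (A *t 1%:M + 1%:M *t B) = expmx A *t expmx B.
Proof.
move=> /hermsymmx_diagonalizable[P [d [Pu ->]]].
move=> /hermsymmx_diagonalizable[Q [e [Qu ->]]].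
rewrite (expmx_similar_real_diag d Pu) (expmx_similar_real_diag e Qu).
rewrite (tensmx_similar_diag _ _ Pu Qu) tensmx_diag.
rewrite (tensmx_sum_similar_diag _ _ Pu Qu).
set f := \row_k (d 0 (mxtens_unindex k).1 + e 0 (mxtens_unindex k).2).
have -> : \row_k (map_mx (real_complex R) d 0 (mxtens_unindex k).1 +
    map_mx (real_complex R) e 0 (mxtens_unindex k).2) =
    map_mx (real_complex R) f.
  by apply/rowP => k; rewrite !mxE rmorphD.
rewrite (expmx_similar_real_diag f (tensmx_unitmx Pu Qu)).
congr (_ *m diag_mx _ *m _).
by apply/rowP => k; rewrite !mxE expRD rmorphM.
Qed.

Definition tens_qsystem (R : realType) (B1 B2 : qsystem R) : qsystem R :=
  @QSystem R (qdim B1 * qdim B2)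
    (etrans (muln_gt0 _ _) (introT andP (conj (qdim_gt0 B1) (qdim_gt0 B2))))
    (ham B1 *t 1%:M + 1%:M *t ham B2)
    (hermsymmxD (tensmx_hermsym (ham_herm B1) (hermsymmx1 _ _))
                (tensmx_hermsym (hermsymmx1 _ _) (ham_herm B2))).

Lemma gibbs_tens (R : realType) (b : R) (B1 B2 : qsystem R) :
  gibbs b (tens_qsystem B1 B2) = gibbs b B1 *t gibbs b B2.
Proof.
(* A real temperature keeps the scaled Hamiltonians Hermitian, as [expmx_tens] requires. *)
have bR : (- b)%:C \is Num.real by apply/complex_realP; exists (- b).
rewrite /gibbs /= scalerDr -tensmxZl -tensmxZr expmx_tens.
- by rewrite mxtrace_tens invfM tensmxZl tensmxZr scalerA.
- exact: hermsymmxZ (ham_herm B1).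
- exact: hermsymmxZ (ham_herm B2).
Qed.

(** * Change of index by a bijection *)

(** For bijective [f], [mxsub f f] is conjugation by a permutation. It also relates index types
    whose dimensions are equal only propositionally, so no casts are needed when tensor factors are
    reordered. *)
Lemma mxsub_bij_mul (R : pzSemiRingType) (m n : nat) (f : 'I_m -> 'I_n)
    (A B : 'M[R]_n) : bijective f ->
  mxsub f f (A *m B) = mxsub f f A *m mxsub f f B.
Proof.
move=> [g fK gK]; apply/matrixP => i j; rewrite !mxE.
rewrite (reindex f) /=; last by exists g => k _.
by apply: eq_bigr => k _; rewrite !mxE.
Qed.

Lemma mxsub_tC (C : numClosedFieldType) (m n : nat) (f : 'I_m -> 'I_n)
    (A : 'M[C]_n) : (mxsub f f A)^t* = mxsub f f (A^t*).
Proof. by apply/matrixP => i j; rewrite !mxE. Qed.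

Lemma mxsub_unitary (C : numClosedFieldType) (m n : nat) (f : 'I_m -> 'I_n)
    (U : 'M[C]_n) : bijective f ->
  U \is unitarymx -> mxsub f f U \is unitarymx.
Proof.
move=> fb /unitarymxP UU; apply/unitarymxP.
rewrite mxsub_tC -mxsub_bij_mul // UU; apply/matrixP => i j.
by rewrite !mxE (inj_eq (bij_inj fb)).
Qed.

Lemma mxsub_comm (R : pzRingType) (m n : nat) (f : 'I_m -> 'I_n)
    (A B : 'M[R]_n) : bijective f ->
  comm_mx A B -> comm_mx (mxsub f f A) (mxsub f f B).
Proof. by move=> fb AB; rewrite /comm_mx -!mxsub_bij_mul // AB. Qed.

Lemma tens1mx_tC (C : numClosedFieldType) (m n : nat) (U : 'M[C]_n) :
  ((1%:M : 'M[C]_m) *t U)^t* = 1%:M *t (U^t*).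
Proof. by rewrite trmx_tens map_mxT trmx1 map_mx1. Qed.

Lemma tens1mx_unitary (C : numClosedFieldType) (m n : nat) (U : 'M[C]_n) :
  U \is unitarymx -> (1%:M : 'M[C]_m) *t U \is unitarymx.
Proof.
move=> /unitarymxP UU; apply/unitarymxP.
by rewrite tens1mx_tC tensmx_mul UU mulmx1 tensmx11.
Qed.

(** [K] acts on the factor that [1%:M *t U] leaves alone. In use, [K] is the Hamiltonian of the
    baths untouched by [U]. *)
Lemma tens1mx_comm (R : comPzRingType) (m n : nat) (K : 'M[R]_m)
    (U W : 'M[R]_n) :
  comm_mx U W -> comm_mx (1%:M *t U) (K *t 1%:M + 1%:M *t W).
Proof.
move=> UW; rewrite /comm_mx mulmxDr mulmxDl !tensmx_mul UW.
by rewrite !mul1mx !mulmx1.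
Qed.

(** * Permutations of the tensor factors *)

Definition interchange (a1 a2 b1 b2 : nat) (k : 'I_((a1 * a2) * (b1 * b2))) :
    'I_((a1 * b1) * (a2 * b2)) :=
  let p := mxtens_unindex k in
  let a := mxtens_unindex p.1 in let b := mxtens_unindex p.2 in
  mxtens_index (mxtens_index (a.1, b.1), mxtens_index (a.2, b.2)).

Lemma interchangeK (a1 a2 b1 b2 : nat) :
  cancel (@interchange a1 a2 b1 b2) (@interchange a1 b1 a2 b2).
Proof.
move=> k; case: (mxtens_indexP k) => p q.
case: (mxtens_indexP p) => p1 p2; case: (mxtens_indexP q) => q1 q2.
by rewrite /interchange !mxtens_indexK /= ?mxtens_indexK.
Qed.

(** Passes from the factor order that [slto] imposes on composite baths to the order with the first
    pair of baths leftmost, where the second unitary has the form [1%:M *t U2]. *)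
Definition split_baths (a1 a2 b1 b2 s : nat)
    (k : 'I_((a1 * a2) * (b1 * b2) * s)) : 'I_((a1 * b1) * ((a2 * b2) * s)) :=
  let p := mxtens_unindex k in
  let q := mxtens_unindex (interchange p.1) in
  mxtens_index (q.1, mxtens_index (q.2, p.2)).

Lemma split_baths_bij (a1 a2 b1 b2 s : nat) :
  bijective (@split_baths a1 a2 b1 b2 s).
Proof.
exists (fun k => let p := mxtens_unindex k in let q := mxtens_unindex p.2 in
  mxtens_index (interchange (mxtens_index (p.1, q.1)), q.2)) => k.
  case: (mxtens_indexP k) => p t; case: (mxtens_indexP p) => a b.
  case: (mxtens_indexP a) => x1 x2; case: (mxtens_indexP b) => y1 y2.
  by rewrite /split_baths /interchange !mxtens_indexK /= ?mxtens_indexK /=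
             ?mxtens_indexK.
case: (mxtens_indexP k) => p t; case: (mxtens_indexP t) => q r.
case: (mxtens_indexP p) => x1 x2; case: (mxtens_indexP q) => y1 y2.
by rewrite /split_baths /interchange !mxtens_indexK /= ?mxtens_indexK /=
           ?mxtens_indexK /= ?mxtens_indexK /= ?mxtens_indexK.
Qed.

(** Brings the second pair of baths to the left, where the first unitary has the form
    [1%:M *t U1]. *)
Definition swap_baths (m1 m2 s : nat) (k : 'I_(m1 * (m2 * s))) :
    'I_(m2 * (m1 * s)) :=
  let p := mxtens_unindex k in let q := mxtens_unindex p.2 in
  mxtens_index (q.1, mxtens_index (p.1, q.2)).

Lemma swap_bathsK (m1 m2 s : nat) :
  cancel (@swap_baths m1 m2 s) (@swap_baths m2 m1 s).
Proof.
move=> k; case: (mxtens_indexP k) => p q; case: (mxtens_indexP q) => q1 q2.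
by rewrite /swap_baths !mxtens_indexK /= ?mxtens_indexK.
Qed.

Lemma swap_baths_bij (m1 m2 s : nat) : bijective (@swap_baths m1 m2 s).
Proof. by exists (@swap_baths m2 m1 s); exact: swap_bathsK. Qed.

(** [mxsub] pulls matrices back along the index map, so the factor order of the domain of
    [split_baths] appears on the right. Both entries are the same product of five scalars,
    rearranged by commutativity. *)
Lemma split_baths_tens (R : comPzRingType) (a1 a2 b1 b2 s : nat)
    (A1 : 'M[R]_a1) (A2 : 'M[R]_a2) (B1 : 'M[R]_b1) (B2 : 'M[R]_b2)
    (S : 'M[R]_s) :
  mxsub (@split_baths a1 a2 b1 b2 s) (@split_baths a1 a2 b1 b2 s)
    ((A1 *t B1) *t ((A2 *t B2) *t S)) =
  ((A1 *t A2) *t (B1 *t B2)) *t S.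
Proof.
apply/matrixP => i j; rewrite mxE.
case: (mxtens_indexP i) => p t; case: (mxtens_indexP p) => a b.
case: (mxtens_indexP a) => x1 x2; case: (mxtens_indexP b) => y1 y2.
case: (mxtens_indexP j) => p' t'; case: (mxtens_indexP p') => a' b'.
case: (mxtens_indexP a') => z1 z2; case: (mxtens_indexP b') => w1 w2.
rewrite /split_baths /interchange !mxtens_indexK /= ?mxtens_indexK !tensmxE.
by rewrite mulrA mulrACA.
Qed.

Lemma swap_baths_tens (R : comPzRingType) (m1 m2 s : nat)
    (A : 'M[R]_m1) (B : 'M[R]_m2) (S : 'M[R]_s) :
  mxsub (@swap_baths m1 m2 s) (@swap_baths m1 m2 s) (B *t (A *t S)) =
  A *t (B *t S).
Proof.
apply/matrixP => i j; rewrite mxE.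
case: (mxtens_indexP i) => i1 i'; case: (mxtens_indexP i') => i2 i3.
case: (mxtens_indexP j) => j1 j'; case: (mxtens_indexP j') => j2 j3.
by rewrite /swap_baths !mxtens_indexK /= ?mxtens_indexK !tensmxE mulrCA.
Qed.

(** * Partial traces over reordered baths *)

Section PartialTrace.
Variable R : realType.

(** Tracing out all baths at once is a double sum, which can be taken over the first pair and then
    over the second. *)
Lemma ptracel_split_baths (a1 a2 b1 b2 s : nat)
    (M : 'M[R[i]]_((a1 * b1) * ((a2 * b2) * s))) :
  ptracel (mxsub (@split_baths a1 a2 b1 b2 s) (@split_baths a1 a2 b1 b2 s) M) =
  ptracel (ptracel M).
Proof.
apply/matrixP => i j; rewrite !mxE.
transitivity (\sum_k2 \sum_k1 M (mxtens_index (k1, mxtens_index (k2, i)))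
  (mxtens_index (k1, mxtens_index (k2, j)))); last first.
  by apply: eq_bigr => k _; rewrite mxE.
rewrite (reindex (@interchange a1 b1 a2 b2)); last first.
  by exists (@interchange a1 a2 b1 b2) => k _; exact: interchangeK.
rewrite sum_mxtens_index exchange_big /=.
apply: eq_bigr => k2 _; apply: eq_bigr => k1 _; rewrite mxE.
case: (mxtens_indexP k1) => x1 y1; case: (mxtens_indexP k2) => x2 y2.
by rewrite /split_baths /interchange !mxtens_indexK /= ?mxtens_indexK.
Qed.

Lemma ptracel_tens1mull (m n : nat) (U : 'M[R[i]]_n) (M : 'M[R[i]]_(m * n)) :
  ptracel ((1%:M *t U) *m M) = U *m ptracel M.
Proof.
apply/matrixP => i j; rewrite !mxE.
under [RHS]eq_bigr do rewrite mxE big_distrr /=.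
rewrite exchange_big /=; apply: eq_bigr => k _.
(* The identity factor keeps only the terms whose bath index is [k]. *)
rewrite mxE sum_mxtens_index (bigD1 k) //= [X in _ + X]big1 ?addr0.
  by apply: eq_bigr => l _; rewrite tensmxE mxE eqxx mul1r.
move=> l lk; apply: big1 => h _.
by rewrite tensmxE mxE eq_sym (negbTE lk) !mul0r.
Qed.

Lemma ptracel_tens1mulr (m n : nat) (U : 'M[R[i]]_n) (M : 'M[R[i]]_(m * n)) :
  ptracel (M *m (1%:M *t U)) = ptracel M *m U.
Proof.
apply/matrixP => i j; rewrite !mxE.
under [RHS]eq_bigr do rewrite mxE big_distrl /=.
rewrite exchange_big /=; apply: eq_bigr => k _.
rewrite mxE sum_mxtens_index (bigD1 k) //= [X in _ + X]big1 ?addr0.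
  by apply: eq_bigr => l _; rewrite tensmxE mxE eqxx mul1r.
move=> l lk; apply: big1 => h _.
by rewrite tensmxE mxE (negbTE lk) mul0r mulr0.
Qed.

(** After the swap the factor [m1] is leftmost and is the one traced out, while [g] is a spectator.
    This is how fresh second baths survive the trace over the first ones. *)
Lemma ptracel_swap_baths (m1 m2 s : nat) (g : 'M[R[i]]_m2)
    (M : 'M[R[i]]_(m1 * s)) :
  ptracel (mxsub (@swap_baths m1 m2 s) (@swap_baths m1 m2 s) (g *t M)) =
  g *t ptracel M.
Proof.
apply/matrixP => i j.
case: (mxtens_indexP i) => i1 i2; case: (mxtens_indexP j) => j1 j2.
rewrite tensmxE !mxE big_distrr /=; apply: eq_bigr => k _.
by rewrite mxE /swap_baths !mxtens_indexK /= ?mxtens_indexK tensmxE.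
Qed.

End PartialTrace.

(** * Conserved quantities under reordering of the factors *)

Lemma mxsubD (V : nmodType) (m n : nat) (f : 'I_m -> 'I_n) (A B : 'M[V]_n) :
  mxsub f f (A + B) = mxsub f f A + mxsub f f B.
Proof. by apply/matrixP => i j; rewrite !mxE. Qed.

Lemma mxsubZ (R : pzRingType) (m n : nat) (f : 'I_m -> 'I_n) (a : R)
    (A : 'M[R]_n) : mxsub f f (a *: A) = a *: mxsub f f A.
Proof. by apply/matrixP => i j; rewrite !mxE. Qed.

Definition local_ham (C : comPzRingType) (m n : nat) (x y : C) (A : 'M[C]_m)
    (B : 'M[C]_n) : 'M[C]_(m * n) :=
  x *: (A *t 1%:M) + y *: (1%:M *t B).

(* (x, y) = (1, 1) and (x, y) = (bA, bB) give the two conserved quantities. *)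
Definition total_ham (C : comPzRingType) (s1 s2 b1 b2 : nat) (x y : C)
    (SA : 'M[C]_s1) (SB : 'M[C]_s2) (BA : 'M[C]_b1) (BB : 'M[C]_b2) :
    'M[C]_(b1 * b2 * (s1 * s2)) :=
  1%:M *t local_ham x y SA SB + local_ham x y BA BB *t 1%:M.

Lemma total_hamE (C : comPzRingType) (s1 s2 b1 b2 : nat) (x y : C)
    (SA : 'M[C]_s1) (SB : 'M[C]_s2) (BA : 'M[C]_b1) (BB : 'M[C]_b2) :
  total_ham x y SA SB BA BB =
  x *: (1%:M *t (SA *t 1%:M) + (BA *t 1%:M) *t 1%:M) +
  y *: (1%:M *t (1%:M *t SB) + (1%:M *t BB) *t 1%:M).
Proof.
rewrite /total_ham /local_ham tensmxDl tensmxDr !tensmxZl !tensmxZr.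
by rewrite 2!scalerDr addrACA.
Qed.

Lemma total_ham11 (C : comPzRingType) (s1 s2 b1 b2 : nat)
    (SA : 'M[C]_s1) (SB : 'M[C]_s2) (BA : 'M[C]_b1) (BB : 'M[C]_b2) :
  total_ham 1 1 SA SB BA BB =
  1%:M *t (SA *t 1%:M) + 1%:M *t (1%:M *t SB) +
  (BA *t 1%:M) *t 1%:M + (1%:M *t BB) *t 1%:M.
Proof. by rewrite total_hamE 2!scale1r addrACA addrA. Qed.

Lemma total_ham_split (C : comPzRingType) (s1 s2 a1 a2 b1 b2 : nat) (x y : C)
    (SA : 'M[C]_s1) (SB : 'M[C]_s2) (A1 : 'M[C]_a1) (A2 : 'M[C]_a2)
    (B1 : 'M[C]_b1) (B2 : 'M[C]_b2) :
  total_ham x y SA SB (A1 *t 1%:M + 1%:M *t A2) (B1 *t 1%:M + 1%:M *t B2) =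
  mxsub (@split_baths a1 a2 b1 b2 (s1 * s2)) (@split_baths a1 a2 b1 b2 (s1 * s2))
    (local_ham x y A1 B1 *t 1%:M + 1%:M *t total_ham x y SA SB A2 B2).
Proof.
have split := @split_baths_tens C a1 a2 b1 b2 (s1 * s2).
(* One instance for the system and one for each of the four bath Hamiltonians, with identities in
   all other slots; linearity then gives the sum. *)
have := split 1%:M 1%:M 1%:M 1%:M (local_ham x y SA SB).
have := split A1 1%:M 1%:M 1%:M 1%:M.
have := split 1%:M A2 1%:M 1%:M 1%:M.
have := split 1%:M 1%:M B1 1%:M 1%:M.
have := split 1%:M 1%:M 1%:M B2 1%:M.
rewrite !tensmx11 => hB2 hB1 hA2 hA1 hS.
rewrite /total_ham tensmxDr 2!mxsubD hS [RHS]addrCA; congr (_ + _).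
rewrite /local_ham !(tensmxDl, tensmxDr, tensmxZl, tensmxZr, mxsubD, mxsubZ).
by rewrite hA1 hA2 hB1 hB2 2!scalerDr addrACA.
Qed.

(** Both sides sum the same three contributions: first baths, second baths and system. Either pair
    of baths can thus be singled out as the spectator. *)
Lemma total_ham_swap (C : comPzRingType) (s1 s2 a1 a2 b1 b2 : nat) (x y : C)
    (SA : 'M[C]_s1) (SB : 'M[C]_s2) (A1 : 'M[C]_a1) (A2 : 'M[C]_a2)
    (B1 : 'M[C]_b1) (B2 : 'M[C]_b2) :
  mxsub (@swap_baths (a1 * b1) (a2 * b2) (s1 * s2))
        (@swap_baths (a1 * b1) (a2 * b2) (s1 * s2))
    (local_ham x y A2 B2 *t 1%:M + 1%:M *t total_ham x y SA SB A1 B1) =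
  local_ham x y A1 B1 *t 1%:M + 1%:M *t total_ham x y SA SB A2 B2.
Proof.
have swap := @swap_baths_tens C (a1 * b1) (a2 * b2) (s1 * s2).
rewrite /total_ham !tensmxDr -!tensmx11 !mxsubD !swap !tensmx11.
by rewrite addrC -addrA addrCA.
Qed.

(** * The composite unitary and its operation *)

Section Composition.
Variables (R : realType) (SA SB : qsystem R).

Lemma slto_unitaryE (BA BB : qsystem R) (bA bB : R)
    (U : 'M[R[i]]_(total_dim SA SB BA BB)) :
  slto_unitary bA bB U <->
  [/\ U \is unitarymx,
      comm_mx U (total_ham 1 1 (ham SA) (ham SB) (ham BA) (ham BB)) &
      comm_mx U (total_ham bA%:C bB%:C (ham SA) (ham SB) (ham BA) (ham BB))].
Proof.
rewrite /slto_unitary.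
have := total_ham11 (ham SA) (ham SB) (ham BA) (ham BB).
rewrite -/(hamSA SA SB BA BB) -/(hamSB SA SB BA BB) -/(hamBA SA SB BA BB)
  -/(hamBB SA SB BA BB) => <-.
have := total_hamE bA%:C bB%:C (ham SA) (ham SB) (ham BA) (ham BB).
rewrite -/(hamSA SA SB BA BB) -/(hamSB SA SB BA BB) -/(hamBA SA SB BA BB)
  -/(hamBB SA SB BA BB) => <-.
by [].
Qed.

Variables (A1 A2 B1 B2 : qsystem R).
Let A := tens_qsystem A1 A2.
Let B := tens_qsystem B1 B2.

(** The types of [phi] and [sigma] match by conversion, since the dimension of [tens_qsystem]
    reduces to a product. *)
Let phi : 'I_(total_dim SA SB A B) ->
    'I_(qdim A1 * qdim B1 * total_dim SA SB A2 B2) :=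
  @split_baths (qdim A1) (qdim A2) (qdim B1) (qdim B2) (sys_dim SA SB).

Let sigma : 'I_(qdim A1 * qdim B1 * total_dim SA SB A2 B2) ->
    'I_(qdim A2 * qdim B2 * total_dim SA SB A1 B1) :=
  @swap_baths (qdim A1 * qdim B1) (qdim A2 * qdim B2) (sys_dim SA SB).

Let phi_bij : bijective phi. Proof. exact: split_baths_bij. Qed.
Let sigma_bij : bijective sigma. Proof. exact: swap_baths_bij. Qed.

Definition compose_unitary (U1 : 'M[R[i]]_(total_dim SA SB A1 B1))
    (U2 : 'M[R[i]]_(total_dim SA SB A2 B2)) :
    'M[R[i]]_(total_dim SA SB A B) :=
  mxsub phi phi ((1%:M *t U2) *m mxsub sigma sigma (1%:M *t U1)).

Lemma compose_unitary_comm (x y : R[i]) U1 U2 :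
  comm_mx U1 (total_ham x y (ham SA) (ham SB) (ham A1) (ham B1)) ->
  comm_mx U2 (total_ham x y (ham SA) (ham SB) (ham A2) (ham B2)) ->
  comm_mx (compose_unitary U1 U2)
    (total_ham x y (ham SA) (ham SB) (ham A) (ham B)).
Proof.
move=> c1 c2; rewrite total_ham_split; apply: mxsub_comm => //.
(* [comm_mxM] takes the product on the right, hence the symmetries. For [U2] the first baths are the
   spectators. *)
apply/comm_mx_sym/comm_mxM; apply/comm_mx_sym; first exact: tens1mx_comm.
(* The same quantity is rewritten with the second baths as spectators, the shape suited to [U1]. *)
rewrite -total_ham_swap; apply: mxsub_comm => //.
exact: tens1mx_comm.
Qed.

Lemma compose_slto_unitary bA bB U1 U2 :
  slto_unitary bA bB U1 -> slto_unitary bA bB U2 ->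
  slto_unitary bA bB (compose_unitary U1 U2).
Proof.
move=> /slto_unitaryE[u1 c1 d1] /slto_unitaryE[u2 c2 d2].
apply/slto_unitaryE.
have c := compose_unitary_comm c1 c2.
have d := compose_unitary_comm d1 d2.
split; [|exact: c|exact: d].
apply: mxsub_unitary => //; apply: mul_unitarymx.
  exact: tens1mx_unitary.
by apply: mxsub_unitary => //; exact: tens1mx_unitary.
Qed.

Lemma slto_map_compose bA bB U1 U2 rho :
  slto_map bA bB (compose_unitary U1 U2) rho =
  slto_map bA bB U2 (slto_map bA bB U1 rho).
Proof.
rewrite /slto_map /compose_unitary !gibbs_tens.
set gA1 := gibbs bA A1; set gA2 := gibbs bA A2.
set gB1 := gibbs bB B1; set gB2 := gibbs bB B2.
(* The initial state is expressed in the order where [U1] acts, so that both transports can later be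
   pulled out of the products. *)
have -> : ((gA1 *t gA2) *t (gB1 *t gB2)) *t rho =
    mxsub phi phi (mxsub sigma sigma ((gA2 *t gB2) *t ((gA1 *t gB1) *t rho))).
  by rewrite swap_baths_tens [RHS]split_baths_tens.
rewrite mxsub_tC -!mxsub_bij_mul // ptracel_split_baths.
rewrite trmx_mul map_mxM mxsub_tC !tens1mx_tC !mulmxA.
(* [U2] and its adjoint leave the inner trace over the first baths; what stays inside is the action
   of [U1] next to the second Gibbs states. *)
rewrite ptracel_tens1mulr -!mulmxA ptracel_tens1mull !mulmxA.
rewrite -!mxsub_bij_mul // !tensmx_mul mul1mx mulmx1 ptracel_swap_baths.
by [].
Qed.

End Composition.

Theorem theorem4 (R : realType) (SA SB : qsystem R) (bA bB : R)
    (L1 L2 : state R (sys_dim SA SB) -> state R (sys_dim SA SB)) :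
  slto bA bB L1 -> slto bA bB L2 -> slto bA bB (L2 \o L1).
Proof.
move=> [A1 [B1 [U1 [uU1 L1E]]]] [A2 [B2 [U2 [uU2 L2E]]]].
exists (tens_qsystem A1 A2), (tens_qsystem B1 B2), (compose_unitary U1 U2).
split; first exact: compose_slto_unitary.
(* [L2E] is used at the state [L1 rho]; only the underlying matrix enters [slto_map], so [L1E] can
   rewrite it. *)
by move=> rho /=; rewrite L2E L1E slto_map_compose.
Qed.
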